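(* Assume $\mathfrak{p}=\mathfrak{c}$. Then there is a set of reals $X$ such that $C_p(X)$ is strongly sequentially separable, but $B_1(X)$ is not strongly sequentially separable.
   Context: $\mathfrak{c}=2^{\aleph_0}$, and $\mathfrak{p}$ is the smallest cardinality of a family of subsets of the natural numbers with the strong finite intersection property (every finite subfamily has infinite intersection) but with no infinite pseudo-intersection (no infinite set almost contained in each member). A set of reals means a zero-dimensional separable metrizable space. $C_p(X)$ is the space of continuous real-valued functions on $X$ with the topology of pointwise convergence; $B_1(X)$ is the space of pointwise limits of sequences of continuous real-valued functions on $X$, with the topology of pointwise convergence. A space $Z$ is strongly sequentially separable if it is separable and, for every countable dense $D\subseteq Z$, every point of $Z$ is the limit of a sequence of points of $D$. *)

(* Defs.v *)
From mathcomp Require Import all_boot all_order all_algebra.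
From mathcomp Require Import all_classical all_reals all_analysis.

Set Implicit Arguments.
Unset Strict Implicit.
Unset Printing Implicit Defensive.

Import Order.TTheory GRing.Theory Num.Theory.
Import numFieldNormedType.Exports.

Local Open Scope classical_set_scope.
Local Open Scope card_scope.

(* [G = set0] is allowed and harmless: its intersection is [setT]. *)
Definition strong_fip (F : set (set nat)) : Prop :=
  forall G : set (set nat), finite_set G -> G `<=` F ->
    infinite_set (\bigcap_(A in G) A).

Definition pseudo_intersection (F : set (set nat)) (P : set nat) : Prop :=
  infinite_set P /\ forall A, F A -> finite_set (P `\` A).

Definition p_family (F : set (set nat)) : Prop :=
  strong_fip F /\ ~ (exists P, pseudo_intersection F P).

(* Cardinals are not objects here: [has_card_p A] says |A| = p. *)
Definition has_card_p T (A : set T) : Prop :=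
  (exists2 F, p_family F & A #= F) /\ (forall F, p_family F -> A #<= F).

(* [nat -> bool] has cardinality 2 ^ aleph_0. *)
Definition p_eq_c : Prop := has_card_p [set: nat -> bool].

Definition separable_space (Z : topologicalType) : Prop :=
  exists2 D : set Z, countable D & dense D.

Definition strongly_sequentially_separable (Z : topologicalType) : Prop :=
  separable_space Z /\
  forall D : set Z, countable D -> dense D ->
    forall z : Z, exists2 u : nat -> Z, (forall n, D (u n)) & u @ \oo --> z.

Definition metrizable (R : realType) (X : topologicalType) : Prop :=
  exists (M : metricType R) (f : X -> M) (g : M -> X),
    [/\ cancel f g, cancel g f, continuous f & continuous g].

(* The library's [zero_dimensional] only asks that distinct points be separated
   by a clopen set, which is strictly weaker for separable metrizable spaces. *)
Definition has_clopen_basis (X : topologicalType) : Prop :=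
  exists2 B : set (set X), basis B & B `<=` clopen.

Definition set_of_reals (R : realType) (X : topologicalType) : Prop :=
  [/\ has_clopen_basis X, separable_space X & metrizable R X].

(* Both function spaces are [set_type]s, so they carry the topology induced by
   the topology of pointwise convergence on all functions. *)
Definition Cp (R : realType) (X : topologicalType) : topologicalType :=
  [set f : {ptws X -> R} | continuous (f : X -> R)].

Definition B1 (R : realType) (X : topologicalType) : topologicalType :=
  [set f : {ptws X -> R} | exists2 g : nat -> X -> R,
    (forall n, continuous (g n)) & forall x, g n x @[n --> \oo] --> f x].

(* Main.v *)
Require Import Defs.
From Stdlib.Wellfounded Require Inverse_Image.
From HB Require Import structures.
From mathcomp Require Import all_boot all_order all_algebra.
From mathcomp Require Import all_classical all_reals all_analysis.
Set Implicit Arguments.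
Unset Strict Implicit.
Unset Printing Implicit Defensive.
Import Order.TTheory GRing.Theory Num.Theory.
Import numFieldNormedType.Exports.
Local Open Scope classical_set_scope.
Local Open Scope card_scope.

(** The space consists of the finitely supported binary sequences together with
    points [x_i], one for each code [i] in a well-ordering of the continuum all
    of whose initial segments have fewer than continuum many elements. Binary
    sequences are read as sets of naturals. The points are chosen recursively
    ([exists_gapped_gamma_set]): each [x_i] is infinite and almost contained in
    all earlier points, which form a chain of fewer than continuum many infinite
    sets and so have a pseudo-intersection by [p = c]. Moreover [x_i] settles
    two tasks that the code [i] describes.

    The first task is a sequence [U] of open sets. If every finite set of points
    available at stage [i] lies in infinitely many [U n], then a second use of
    [p = c] gives a subsequence of [U] in which every available point lies
    eventually. An open set around a finitely supported point contains all
    sequences that continue it by a long enough block of zeros, so [x_i] can be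
    chosen so sparse that it, and everything almost contained in it, eventually
    lies in the members of a further subsequence ([gapped_point], after Galvin
    and Miller). All later points are almost contained in [x_i], so the
    subsequence serves the whole space: the space is a gamma-set. Given a
    countable dense set [D] in [C_p], the sets where an element of [D] is close
    to [z] form such a cover, and the subsequence is a sequence in [D] that
    converges to [z] ([Cp_strongly_sequentially_separable]).

    The second task is a function [g]; after each of its elements [q] the set
    [x_i] has a gap up to [g q]. The set [window n m] of all [y] that lie below
    [n] or meet the open interval from [n] to [m] has a characteristic function
    of the first Baire class, and every finite set of points lies in a window.
    Hence the functions that are a rational step function on a window and [1]
    off it are dense in [B_1]. If a sequence of them converged to [0], every
    point would eventually lie in the corresponding windows. The singletons
    force the left ends [n] to infinity, and a point whose gaps grow faster than
    the windows is then missed infinitely often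
    ([B1_not_strongly_sequentially_separable]). *)

(** * Binary sequences, read as sets of natural numbers *)

Notation points := (nat -> bool).

Definition below_c T (A : set T) : Prop := ~ ([set: points] #<= A).

Definition frequently (A : nat -> Prop) : Prop :=
  forall N, exists2 n, N <= n & A n.

Definition eventually_zero (x : points) : Prop := \forall n \near \oo, ~~ x n.

Definition almost_sub (A B : nat -> Prop) : Prop :=
  \forall n \near \oo, A n -> B n.

Lemma infinite_setP (A : set nat) : infinite_set A <-> frequently A.
Proof.
split=> [iA N|fA].
  apply: contrapT => H; apply: iA.
  apply: (@sub_finite_set _ _ `I_N); last exact: finite_II.
  move=> n An /=; rewrite ltnNge; apply/negP => Nn; apply: H.
  by exists n.
move=> /finite_seqP[s sE].
have [n nge An] := fA (\max_(i <- s) i).+1.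
have : n \in s by move: An; rewrite sE.
move=> ns; have : n <= \max_(i <- s) i by rewrite (big_rem n)//= leq_max leqnn.
by move=> /(leq_trans nge); rewrite ltnn.
Qed.

Lemma finite_set_eventually (A B : set nat) :
  finite_set (A `\` B) -> almost_sub A B.
Proof.
move=> fin; have : ~ frequently (A `\` B) by move/infinite_setP.
move=> /existsNP[N HN]; exists N => // n /= Nn An.
by apply: contrapT => nB; apply: HN; exists n.
Qed.

Lemma near_all_seq (I : eqType) (s : seq I) (P : I -> nat -> Prop) :
  (forall i, i \in s -> \forall n \near \oo, P i n) ->
  \forall n \near \oo, forall i, i \in s -> P i n.
Proof.
elim: s => [|i s IH] H; first by near=> n.
have Hi := H i (mem_head _ _).
have Hs := IH (fun j js => H j (@mem_behead _ (i :: s) j js)).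
by apply: filterS2 Hi Hs => n Pi Ps j; rewrite inE => /predU1P[->|/Ps].
Unshelve. all: by end_near. Qed.

(** Used with [n l] the index attached to the [l]-th member of a convergent
    sequence, where each value [j] is excluded by the singleton of [j]. *)
Lemma near_neq_all (n : nat -> nat) :
  (forall j, \forall l \near \oo, n l <> j) ->
  forall J, \forall l \near \oo, J <= n l.
Proof.
move=> nj J; have : \forall l \near \oo, forall j, j \in iota 0 J -> n l <> j.
  apply: (@near_all_seq _ (iota 0 J) (fun j l => n l <> j)) => j _.
  exact: nj.
apply: filterS => l nl; rewrite leqNgt; apply/negP => nlJ.
by apply: (nl (n l)) => //; rewrite mem_iota.
Qed.

Lemma almost_sub_trans A B C :
  almost_sub A B -> almost_sub B C -> almost_sub A C.
Proof. by rewrite /almost_sub; apply: filterS2 => n AB BC /AB/BC. Qed.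

Lemma almost_sub_refl A : almost_sub A A.
Proof. by exists 0. Qed.

Definition agree (k : nat) (x y : points) : Prop :=
  forall n, n < k -> x n = y n.

Lemma agree_sym k (a b : points) : agree k a b -> agree k b a.
Proof. by move=> ab n /ab. Qed.

Lemma agree_trans k (a b c : points) :
  agree k a b -> agree k b c -> agree k a c.
Proof. by move=> ab bc n nk; rewrite ab// bc. Qed.

Lemma leq_agree k l (a b : points) : k <= l -> agree l a b -> agree k a b.
Proof. by move=> kl ab n nk; apply: ab; apply: leq_trans kl. Qed.

Lemma mkseq_agree (x y : points) k : mkseq x k = mkseq y k <-> agree k x y.
Proof.
split=> [E n nk|E]; last first.
  apply: (@eq_from_nth _ false); rewrite !size_mkseq// => n nk.
  by rewrite !nth_mkseq ?E.
by have := congr1 (nth false ^~ n) E; rewrite !nth_mkseq.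
Qed.

Lemma separating_prefix (s : seq points) :
  exists k, {in s &, forall x y, agree k x y -> x = y}.
Proof.
elim: s => [|x s [k kP]]; first by exists 0.
have sep y : \forall k \near \oo, agree k x y -> x = y.
  have [->|xy] := eqVneq x y; first by exists 0.
  have [n xyn] : exists n, x n <> y n.
    by apply: contrapT => H; move/eqP: xy; apply; apply/funext => n;
      apply: contrapT => xyn; apply: H; exists n.
  by exists n.+1 => // l /= nl /(_ n nl).
have [l _ lP] : \forall l \near \oo, forall y, y \in s -> agree l x y -> x = y.
  exact: (@near_all_seq _ s (fun y l => agree l x y -> x = y)).
exists (maxn k l) => y z.
have Hl w : w \in s -> agree (maxn k l) x w -> x = w.
  by move=> /(lP l (leqnn l)) H /(leq_agree (leq_maxr k l)).
rewrite !inE => /predU1P[->|ys] /predU1P[->|zs] //; first exact: Hl.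
  by move=> /agree_sym /(Hl _ ys).
by move=> /(leq_agree (leq_maxl k l)); exact: kP.
Unshelve. all: by end_near. Qed.

Lemma countable_eventually_zero : countable eventually_zero.
Proof.
pose F (t : seq bool) : points := nth false t.
have sF : eventually_zero `<=` range F.
  move=> x [N _ xN]; exists (mkseq x N) => //.
  apply/funext => n; have [nN|Nn] := ltnP n N; first by rewrite /F nth_mkseq.
  by rewrite /F nth_default ?size_mkseq//; apply/esym/negbTE/xN.
apply: card_le_trans (subset_card_le sF) _.
apply: card_le_trans (card_image_le _ _) _; exact: countableP.
Qed.

Definition indicator1 (j : nat) : points := fun i => i == j.

Lemma indicator1_eventually_zero j : eventually_zero (indicator1 j).
Proof. by exists j.+1 => // n /= jn; rewrite /indicator1 gtn_eqF. Qed.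

(** * Cardinals below the continuum *)

Definition interleave (a b : points) : points :=
  fun n => if odd n then a n./2 else b n./2.

Lemma interleave_inj a b a' b' :
  interleave a b = interleave a' b' -> a = a' /\ b = b'.
Proof.
move=> E; split; apply/funext => n.
  have /(congr1 (@^~ n.*2.+1)) := E.
  by rewrite /interleave /= odd_double /= uphalf_double.
by have /(congr1 (@^~ n.*2)) := E; rewrite /interleave odd_double doubleK.
Qed.

Lemma continuum_uncountable : ~ ([set: points] #<= [set: nat]).
Proof.
move=> /pcard_surjP[h hs].
have [n _ /(congr1 (@^~ n))] := hs (fun n => ~~ h n n) I.
by case: (h n n).
Qed.

(** Split the continuum into continuum many fibres of size continuum. In an
    injection into [A `|` S], either some fibre goes entirely into [S], or each
    fibre contributes a different element of the countable set [A]. *)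
Lemma below_cU (T : pointedType) (A S : set T) :
  countable A -> below_c S -> below_c (A `|` S).
Proof.
move=> cA cS /pcard_leP[f].
have finj a b a' b' :
    f (interleave a b) = f (interleave a' b') -> a = a' /\ b = b'.
  by move=> /(inj (in_setT _) (in_setT _)) /interleave_inj.
have [[a Ha]|H] := pselect (exists a, forall b, S (f (interleave a b))).
  apply: cS; apply/pcard_leP/injfunPex.
  exists (fun b => f (interleave a b)); first by move=> b _; exact: Ha.
  by move=> b b' _ _ /finj[].
have /choice[c cP] : forall a, exists b, A (f (interleave a b)).
  move=> a; have /existsNP[b Sb] := (forallNP _).2 H a; exists b.
  by have [] := @funS _ _ _ _ f (interleave a b) I.
apply: continuum_uncountable; apply: card_le_trans cA.
apply/pcard_leP/injfunPex; exists (fun a => f (interleave a (c a))).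
  by move=> a _; exact: cP.
by move=> a b _ _ /finj[].
Qed.

(** If the initial segments of a well-ordering are not all small, inject the
    continuum into the least segment that is not small and pull the order
    back. *)
Lemma continuum_well_order : exists lt : points -> points -> Prop,
  [/\ well_founded lt, forall i j, [\/ lt i j, i = j | lt j i] &
      forall i, below_c [set j | lt j i]].
Proof.
have [R Rwo] := wochoice.well_ordering_principle points.
have Rch := wochoice.withinW Rwo.
have Rtot : total R.
  by move=> x y; apply: (wochoice.wo_chainW (Rch predT)).
have Ranti : antisymmetric R.
  by move=> x y; apply: (wochoice.wo_chain_antisymmetric (Rch predT)).
pose lt0 x y := R x y && (x != y).
have min (P : set points) : P !=set0 ->
    exists2 z, P z & forall y, lt0 y z -> ~ P y.
  move=> [p Pp]; have [|z [[Pz lbz] _]] := Rwo [pred x | `[< P x >]].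
    by exists p; apply/asboolP.
  exists z; first exact/asboolP.
  move=> y /andP[Ryz ynz] Py; move/eqP: ynz; apply; apply: Ranti.
  by rewrite Ryz lbz//; apply/asboolP.
have wf0 : well_founded lt0.
  move=> x; apply: contrapT => nx.
  have [z nz H] := min [set x | ~ Acc lt0 x] (ex_intro _ x nx).
  by apply: nz; constructor => y /H /contrapT.
have tri0 i j : [\/ lt0 i j, i = j | lt0 j i].
  have [->|nij] := eqVneq i j; first by constructor 2.
  by have /orP[Rij|Rji] := Rtot i j; [constructor 1|constructor 3];
    rewrite /lt0 ?Rij ?Rji// eq_sym.
have [small|] := pselect (forall i, below_c [set j | lt0 j i]).
  by exists lt0.
move=> /existsNP/min[i0 /contrapT/pcard_leP[h] i0min].
have hinj : injective h by move=> x y; apply: inj; rewrite in_setT.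
exists (fun i j => lt0 (h i) (h j)); split.
- exact: (Inverse_Image.wf_inverse_image _ _ lt0 h wf0).
- by move=> i j; have [?|/hinj ?|?] := tri0 (h i) (h j);
    [constructor 1|constructor 2|constructor 3].
- move=> i; have hi := @funS _ _ _ _ h i I.
  have /contrapT smalli := i0min _ hi.
  move=> /card_le_trans cle; apply: smalli; apply: cle.
  apply/pcard_leP/injfunPex; exists h => [j //|].
  by move=> x y _ _ /hinj.
Qed.

(** Dependent choice along a well-founded relation. A step may rely on the
    requirements already being met at all earlier stages, which is why the
    choice is made only when a suitable value exists. *)
Lemma wf_recursive_choice (I T : Type) (t0 : T) (lt : I -> I -> Prop)
    (Q : I -> (I -> T) -> T -> Prop) :
  well_founded lt ->
  (forall i x x' y, (forall j, lt j i -> x j = x' j) -> Q i x y -> Q i x' y) ->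
  (forall i x, (forall j, lt j i -> Q j x (x j)) -> exists y, Q i x y) ->
  exists x, forall i, Q i x (x i).
Proof.
move=> wf ext step.
have choose (P : T -> Prop) : {y | (exists z, P z) -> P y}.
  have [H|H] := pselect (exists z, P z); last by exists t0.
  by have [y Py] := cid H; exists y.
pose F i (rec : forall j, lt j i -> T) : T := sval (choose (Q i
  (fun j => if pselect (lt j i) is left h then rec j h else t0))).
pose x := Fix wf (fun=> T) F.
have xE i : x i = sval (choose (Q i
    (fun j => if pselect (lt j i) is left _ then x j else t0))).
  rewrite /x Fix_eq// => k f g fg; rewrite /F; congr (sval (choose (Q k _))).
  by apply/funext => j; case: pselect.
exists x; elim/(well_founded_ind wf) => i IH.
rewrite xE; case: (choose _) => y /= Py.
have {}Py : Q i (fun j => if pselect (lt j i) is left _ then x j else t0) y.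
  apply: Py; have [z Qz] := step i x IH; exists z.
  by apply: ext Qz => j ji; case: pselect.
by apply: ext Py => j ji; case: pselect.
Qed.

(** The form in which [p = c] is used: for fewer than continuum many sets with
    the strong finite intersection property it yields a pseudo-intersection.
    The indexed form covers both families of the construction, the earlier
    points of a stage and the sets of indices [n] with [x] in [U n]. *)
Lemma below_c_pseudo_intersection (I : pointedType) (S : set I)
    (A : I -> set nat) : p_eq_c -> below_c S ->
  (forall s : seq I, {in s, forall i, S i} ->
     frequently (fun n => {in s, forall i, A i n})) ->
  exists2 B : set nat, frequently B & forall i, S i -> almost_sub B (A i).
Proof.
move=> [_ pc] cS fip.
have [B [iB Bsub]] : exists P, pseudo_intersection (A @` S) P.
  apply: contrapT => noP; apply: cS.
  apply: card_le_trans (card_image_le A S); apply: pc; split => // G.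
  move=> /finite_seqP[s ->] sS.
  apply/infinite_setP => N.
  have /choice[c cP] : forall a, exists i, a \in s -> S i /\ A i = a.
    move=> a; case: (boolP (a \in s)) => [/sS[i Si <-]|_]; first by exists i.
    by exists point.
  have [|n Nn H] := fip (map c s) _ N.
    by move=> _ /mapP[a /cP[Sa _] ->].
  exists n => // a /= sa; have [_ <-] := cP _ sa; exact/H/map_f.
exists B; first exact/infinite_setP.
by move=> i Si; apply/finite_set_eventually/Bsub; exists i.
Qed.

(** * Omega-covers captured by a single sparse set *)

Lemma sparse_sequence (P : nat -> Prop) (h : nat -> nat) : frequently P ->
  exists p : nat -> nat,
    forall l, P (p l) /\ maxn (p l).+1 (h (p l)) <= p l.+1.
Proof.
move=> fP; have /choice[nx nxP] : forall N, exists n, N <= n /\ P n.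
  by move=> N; have [n ? ?] := fP N; exists n.
exists (fun l => iter l (fun q => nx (maxn q.+1 (h q))) (nx 0)) => l.
split; last by rewrite iterS; exact: (nxP _).1.
by case: l => [|l]; rewrite ?iterS; exact: (nxP _).2.
Qed.

Definition cantor_open (U : set points) : Prop :=
  forall x, U x -> exists k, forall y, agree k x y -> U y.

(** Asking for infinitely many [n], instead of for one, is automatic for covers
    by proper subsets and makes the sets of indices with [x] in [U n] have the
    strong finite intersection property. *)
Definition omega_cover (S : set points) (U : nat -> set points) : Prop :=
  forall s : seq points, {in s, forall x, S x} ->
    frequently (fun n => {in s, forall x, U n x}).

Definition gamma_subsequence (S : set points) (U : nat -> set points)
    (t : nat -> nat) : Prop :=
  forall x, S x -> \forall l \near \oo, U (t l) x.

Definition gapped (g : nat -> nat) (x : points) : Prop :=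
  forall p q, x p -> p < q < g p -> ~~ x q.

(** The subset of [P] is the range of a sequence [p] that jumps past [h (p l)]
    after each of its terms. *)
Lemma sparse_subset (P : nat -> Prop) (h : nat -> nat) : frequently P ->
  exists p : nat -> nat, [/\ forall l, P (p l), forall l, l <= p l &
    forall l q, p l < q < h (p l) -> forall k, q <> p k].
Proof.
move=> /(sparse_sequence h)[p pP]; exists p.
have lt_p l : p l < p l.+1.
  by apply: leq_trans (pP l).2; rewrite leq_max leqnn.
have p_mono : {mono p : i j / i <= j}.
  by apply: leq_mono; apply: homo_ltn lt_p => a b c; exact: ltn_trans.
split=> [l|l|l q /andP[lq qh] k qk]; first exact: (pP l).1.
  by elim: l => // l IH; apply: leq_ltn_trans IH _.
have : p l < p k < p l.+1.
  rewrite -qk lq (leq_trans qh)// (leq_trans _ (pP l).2)//.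
  by rewrite leq_max leqnn orbT.
by rewrite !(leqW_mono p_mono) ltnS; case: leqP.
Qed.

(** A sequence [z] that vanishes from [m] up to a bound agrees up to that bound
    with one of the finitely many sequences supported below [m]. All of these
    lie in a common [U t], and since [U t] is open one finite bound works for
    all of them. *)
Lemma cover_beyond_gap (U : nat -> set points) (B : nat -> Prop) :
  (forall n, cantor_open (U n)) -> frequently B ->
  (forall x, eventually_zero x -> almost_sub B (fun n => U n x)) ->
  forall m, exists th : nat * nat, [/\ m <= th.1, B th.1 &
    forall z : points, (forall q, m <= q < th.2 -> ~~ z q) -> U th.1 z].
Proof.
move=> oU fB BU m.
pose pad (a : m.-tuple bool) : points := nth false a.
have padfin a : eventually_zero (pad a).
  by exists m => // n /= mn; rewrite /pad nth_default// size_tuple.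
have /choice[N NP] : forall a : m.-tuple bool, exists N,
    forall n, N <= n -> B n -> U n (pad a).
  by move=> a; have [N _ NP] := BU _ (padfin a); exists N => n /NP.
have [t Nt Bt] := fB (maxn m (\max_a N a)).
have /choice[k kP] : forall a : m.-tuple bool, exists k,
    forall z, agree k (pad a) z -> U t z.
  move=> a; apply: oU; apply: NP => //; apply: leq_trans Nt.
  by rewrite leq_max (leq_bigmax a) orbT.
exists (t, \max_a k a); split=> //=.
  by apply: leq_trans Nt; rewrite leq_max leqnn.
move=> z z0; pose a := [tuple z i | i < m]; apply: (kP a) => n nk.
have [nm|mn] := ltnP n m.
  by rewrite /pad (nth_map (Ordinal nm)) ?size_enum_ord// nth_enum_ord.
rewrite /pad nth_default ?size_tuple//; apply/esym/negbTE/z0.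
by rewrite mn (leq_trans nk)// (leq_bigmax a).
Qed.

(** One stage of the recursion. The gaps of [y] are made long enough for [g] and
    for [cover_beyond_gap]; the members of the subsequence are those that the
    latter assigns to the gaps of [y]. A set almost contained in [y] has all but
    finitely many of these gaps too. *)
Lemma gapped_point (P : nat -> Prop) (g : nat -> nat) (U : nat -> set points)
    (S : set points) : p_eq_c -> frequently P ->
  below_c S -> eventually_zero `<=` S -> (forall n, cantor_open (U n)) ->
  exists y : points, [/\ frequently y, almost_sub y P, gapped g y &
    omega_cover S U -> exists t, gamma_subsequence S U t /\
      gamma_subsequence [set z | almost_sub z y] U t].
Proof.
move=> pc fP cS finS oU.
have spread h : exists p (y : points), [/\ forall q, y q <-> exists l, q = p l,
    frequently y, almost_sub y P, forall l, l <= p l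
    & forall l q, p l < q < h (p l) -> ~~ y q].
  have [p [pP lp pg]] := sparse_subset h fP.
  exists p, (fun q => `[< exists l, q = p l >]); split => //.
  - by move=> q; split => /asboolP.
  - by move=> N; exists (p N) => //; apply/asboolP; exists N.
  - by exists 0 => // q _ /asboolP[l ->].
  - by move=> l q /pg H; apply/asboolP => -[k]; exact: H.
have [cov|ncov] := pselect (omega_cover S U); last first.
  have [p [y [yp fy yP _ yg]]] := spread g.
  by exists y; split => // _ q /yp[l ->]; exact: yg.
have [B fB BU] := below_c_pseudo_intersection pc cS cov.
have /choice[th thP] := cover_beyond_gap oU fB (fun x fx => BU x (finS x fx)).
have [p [y [yp fy yP lp yg]]] :=
  spread (fun q => maxn (g q) (th q.+1).2).
exists y; split => //.
  move=> _ q /yp[l ->] /andP[lq qg]; apply: (yg l).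
  by rewrite lq leq_max qg.
move=> _; exists (fun l => (th (p l).+1).1).
have lt l : l <= (th (p l).+1).1.
  have [H _ _] := thP (p l).+1; apply: leq_trans H.
  by apply: leq_trans (lp l) _.
split=> [x /BU[N _ NP]|z [N _ NP]]; exists N => // l /= Nl.
  by apply: NP; [exact: leq_trans Nl (lt l)|have [] := thP (p l).+1].
have [_ _] := thP (p l).+1; apply => q /andP[pq qh].
apply/negP => zq; suff /negP : ~~ y q.
  by apply; apply: NP zq; apply: leq_trans Nl (leq_trans (lp l) (ltnW pq)).
by apply: (yg l); rewrite pq leq_max qh orbT.
Qed.

(** * The recursive construction *)

(** A code is a set of finite pieces of information: a pair [(n, s)] puts the
    cylinder of [s] inside [U n], and a pair [(p, v)] says that [g p = v]. *)
Definition code_entry : countType := ((nat * seq bool) + (nat * nat))%type.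

Definition coded_cover (i : points) (n : nat) : set points :=
  [set y | exists k, i (choice.pickle (inl (n, mkseq y k) : code_entry))].

Definition coded_gap (i : points) (p : nat) : nat :=
  xget 0 [set v | i (choice.pickle (inr (p, v) : code_entry))].

Lemma exists_code (W : nat -> set (seq bool)) (g : nat -> nat) :
  exists i, coded_gap i = g /\
    forall n y, coded_cover i n y <-> exists k, W n (mkseq y k).
Proof.
pose value (a : code_entry) := match a with
  | inl (n, s) => `[< W n s >] | inr (p, v) => v == g p end.
pose i c := if choice.unpickle c is Some a then value a else false.
have iE a : i (choice.pickle a) = value a by rewrite /i choice.pickleK.
exists i; split=> [|n y].
  apply/funext => p; rewrite /coded_gap.
  have -> : [set v | i (choice.pickle (inr (p, v) : code_entry))] = [set g p].
    by apply/seteqP; split=> v; rewrite /mkset iE => /eqP.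
  exact: xget_unique.
split=> -[k]; first by rewrite iE => /asboolP; exists k.
by exists k; rewrite /mkset iE; apply/asboolP.
Qed.

Lemma coded_cover_open i n : cantor_open (coded_cover i n).
Proof.
by move=> x [k ik]; exists k => y /mkseq_agree E; exists k; rewrite -E.
Qed.

(** Almost inclusion is transitive, so a finite part of the chain has a member
    almost contained in all of it; this gives the chain the strong finite
    intersection property. *)
Lemma chain_min (I : eqType) (lt : I -> I -> Prop) (x : I -> nat -> Prop)
    (D : set I) : (forall i j, [\/ lt i j, i = j | lt j i]) ->
  (forall i j, D i -> D j -> lt j i -> almost_sub (x i) (x j)) ->
  forall s : seq I, {in s, forall i, D i} -> s <> [::] ->
  exists2 j, j \in s & forall k, k \in s -> almost_sub (x j) (x k).
Proof.
move=> tri dec; elim=> // i [|j s] IH D' _.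
  exists i; rewrite ?inE// => k.
  by rewrite inE => /eqP ->; exact: almost_sub_refl.
have [| |m ms mP] := IH => //.
  by move=> k ks; apply: D'; rewrite inE ks orbT.
have Di : D i by apply: D'; rewrite mem_head.
have Dm : D m by apply: D'; rewrite inE ms orbT.
have [lim|E|lmi] := tri i m.
- exists m; first by rewrite inE ms orbT.
  by move=> k; rewrite inE => /predU1P[->|/mP//]; exact: dec.
- exists m; first by rewrite inE ms orbT.
  move=> k; rewrite inE => /predU1P[->|/mP//].
  by rewrite E; exact: almost_sub_refl.
- exists i; first by rewrite mem_head.
  move=> k; rewrite inE => /predU1P[->|/mP H]; first exact: almost_sub_refl.
  by apply: almost_sub_trans H; exact: dec.
Qed.

(** The final set is not known when codes are decoded, so covers of it are
    given by relatively open sets and turned into open ones by their codes. *)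
Definition relatively_open (X U : set points) : Prop :=
  forall x, X x -> U x -> exists k, forall y, X y -> agree k x y -> U y.

Definition gamma_set (X : set points) : Prop :=
  forall U : nat -> set points, (forall n, relatively_open X (U n)) ->
    omega_cover X U -> exists t, gamma_subsequence X U t.

Lemma sub_omega_cover (S S' : set points) U V : S `<=` S' ->
  (forall n x, S x -> U n x -> V n x) -> omega_cover S' U -> omega_cover S V.
Proof.
move=> SS' UV cov s sS N.
have [n Nn Un] := cov s (fun x xs => SS' _ (sS x xs)) N.
by exists n => // x xs; apply: UV; [exact: sS|exact: Un].
Qed.

(** Being a gamma-set gives the positive half of the theorem, and the points
    with prescribed gaps give the negative half. *)
Lemma exists_gapped_gamma_set : p_eq_c -> exists X : set points,
  [/\ eventually_zero `<=` X, gamma_set X &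
    forall g, exists2 x, X x & frequently x /\ gapped g x].
Proof.
move=> pc; have [lt [wf tri small]] := continuum_well_order.
pose S i (x : points -> points) : set points :=
  eventually_zero `|` x @` [set j | lt j i].
pose Q i (x : points -> points) (y : points) := [/\ frequently y,
  forall j, lt j i -> almost_sub y (x j), gapped (coded_gap i) y &
  omega_cover (S i x) (coded_cover i) -> exists t,
    gamma_subsequence (S i x) (coded_cover i) t /\
    gamma_subsequence [set z | almost_sub z y] (coded_cover i) t].
have [||x Qx] := @wf_recursive_choice points points point lt Q wf.
- move=> i x x' y xx'; rewrite /Q.
  have -> : S i x' = S i x by congr (_ `|` _); apply: eq_imagel => j /= /xx' ->.
  by move=> [? H ? ?]; split => // j ji; rewrite -xx'//; exact: H.
- move=> i x IH.
  have [P fP Px] : exists2 P : set nat, frequently P &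
      forall j, lt j i -> almost_sub P (x j).
    apply: (below_c_pseudo_intersection pc (small i)) => s sD.
    have [->|s0] := pselect (s = [::]); first by move=> N; exists N.
    have [|j js jP] := chain_min tri _ sD s0 (x := x).
      by move=> k j Dk _; have [_ H _ _] := IH k Dk; exact: H.
    have [fj _ _ _] := IH j (sD j js).
    have [M _ MP] := near_all_seq jP => N.
    have [n] := fj (maxn M N); rewrite geq_max => /andP[Mn Nn] xjn.
    by exists n => // k ks; exact: MP.
  have cS : below_c (S i x).
    apply: below_cU; first exact: countable_eventually_zero.
    by move=> H; apply: (small i); apply: card_le_trans H (card_image_le _ _).
  have [y [fy yP gy cy]] := gapped_point (coded_gap i) pc fP cS
    (fun b => @or_introl _ _) (@coded_cover_open i).
  exists y; split => // j /Px; exact: almost_sub_trans.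
exists (eventually_zero `|` range x); split.
- by move=> y; left.
- move=> U oU cov.
  (* The union of the cylinders in [W n] has the same trace on the space as
     [U n]. *)
  pose W n : set (seq bool) := [set s |
    forall y, (eventually_zero `|` range x) y -> mkseq y (size s) = s -> U n y].
  have [i [_ iW]] := exists_code W id.
  have codeU n y :
      (eventually_zero `|` range x) y -> coded_cover i n y <-> U n y.
    move=> Xy; split=> [/iW[k Wy]|Uy].
      by apply: Wy => //; rewrite size_mkseq.
    have [k kP] := oU n y Xy Uy; apply/iW; exists k => z Xz.
    by rewrite size_mkseq => E; apply: kP => //; apply/mkseq_agree/esym.
  have [_ _ _ [|t [tS tx]]] := Qx i.
    apply: sub_omega_cover cov.
      by move=> y [?|[j _ <-]]; [left|right; exists j].
    by move=> n y [?|[j _ <-]] Uy; apply/codeU => //; [left|right; exists j].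
  exists t => y Xy.
  suff : \forall l \near \oo, coded_cover i (t l) y.
    by apply: filterS => l /codeU; exact.
  case: Xy => [fy|[j _ <-]]; first by apply: tS; left.
  have [ji|->|ij] := tri j i; first by apply: tS; right; exists j.
    by apply: tx; exact: almost_sub_refl.
  by apply: tx; have [_ H _ _] := Qx j; exact: H.
- move=> g; have [i [<- _]] := exists_code (fun=> set0) g.
  by exists (x i); [right; exists i|have [] := Qx i].
Qed.

(** * Windows *)

Definition window (n m : nat) (y : points) : Prop :=
  (forall q, y q -> q < n) \/ exists2 q, n < q < m & y q.

Definition truncate (k : nat) (y : points) : points := fun q => (q < k) && y q.

(** The interval of a window is open on the left so that the singleton of its
    left end is left out. *)
Lemma window_indicator1 n m : ~ window n m (indicator1 n).
Proof.
case=> [H|[q /andP[nq _]]]; last by rewrite /indicator1 gtn_eqF.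
by have := H n; rewrite /indicator1 eqxx ltnn => /(_ isT).
Qed.

(** This makes the characteristic function of a window a pointwise limit of
    locally constant functions. *)
Lemma window_truncate n m y :
  \forall k \near \oo, window n m (truncate k y) <-> window n m y.
Proof.
have [yn|] := pselect (forall q, y q -> q < n).
  by exists 0 => // k _; split=> _; left => // q /andP[_]; exact: yn.
move=> /existsNP[q /not_implyP[yq /negP]]; rewrite -leqNgt => nq.
have [[r nrm yr]|nr] := pselect (exists2 r, n < r < m & y r).
  exists r.+1 => // k /= rk; split=> _; right; exists r => //.
  by rewrite /truncate rk.
exists q.+1 => // k /= qk; split=> -[H|[r nrm]].
- by have := H q; rewrite /truncate qk yq => /(_ isT); rewrite ltnNge nq.
- by case/andP=> _ yr; case: nr; exists r.
- by have := H q yq; rewrite ltnNge nq.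
- by move=> yr; case: nr; exists r.
Qed.

(** First [n] is taken above all finite sets in [s], then [m] so large that each
    infinite one meets the interval. *)
Lemma windows_omega_cover (s : seq points) :
  exists n m, forall y, y \in s -> window n m y.
Proof.
have [n _ nP] : \forall n \near \oo, forall y, y \in s -> eventually_zero y ->
    forall q, y q -> q < n.
  apply: (@near_all_seq _ s (fun y n => eventually_zero y ->
    forall q, y q -> q < n)) => y _.
  have [[N _ yN]|ny] := pselect (eventually_zero y); last by exists 0.
  exists N => // n /= Nn _ q yq; apply: leq_trans Nn.
  by rewrite ltnNge; apply/negP => /yN; rewrite yq.
have [m _ mP] : \forall m \near \oo, forall y, y \in s -> window n m y.
  apply: (@near_all_seq _ s (fun y m => window n m y)) => y ys.
  have [y0|ny] := pselect (eventually_zero y).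
    by exists 0 => // m _; left; exact: nP (leqnn n) _ ys y0.
  have [q nq yq] : exists2 q, n < q & y q.
    apply: contrapT => H; apply: ny; exists n.+1 => // q /= nq.
    by apply/negP => yq; apply: H; exists q.
  by exists q.+1 => // m /= qm; right; exists q; rewrite ?nq.
by exists n, m; exact: mP (leqnn m).
Qed.

(** * The metric space of a set of binary sequences *)

Local Open Scope ring_scope.

Section PrefixDistance.
Context {R : realType}.
Implicit Types x y z : points.

(** The reciprocal of one plus the first place where the sequences differ. *)
Definition prefix_dist x y : R :=
  if pselect (exists n, x n != y n) is left e then (ex_minn e).+1%:R^-1 else 0.

Lemma prefix_dist_lt x y k : prefix_dist x y < k.+1%:R^-1 <-> agree k.+1 x y.
Proof.
rewrite /prefix_dist; case: pselect => [e|ne]; last first.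
  split=> _; last by rewrite invr_gt0.
  by move=> n _; apply: contrapT => /eqP xy; apply: ne; exists n.
case: ex_minnP => m xym mmin; rewrite ltf_pV2 ?posrE// ltr_nat ltnS.
split=> [km n nk|E].
  apply/eqP; apply: contraTT (nk) => /mmin mn.
  by rewrite -leqNgt (leq_trans km).
by rewrite ltnNge; apply/negP => /E /eqP; apply/negP.
Qed.

Lemma prefix_dist_sym x y : prefix_dist x y = prefix_dist y x.
Proof.
suff le a b : prefix_dist a b <= prefix_dist b a.
  by apply/eqP; rewrite eq_le !le.
rewrite {2}/prefix_dist; case: pselect => [e|ne].
  case: ex_minnP => m bam mmin; rewrite /prefix_dist.
  case: pselect => [e'|//]; case: ex_minnP => m' abm m'min.
  by rewrite lef_pV2 ?posrE// ler_nat ltnS; apply: mmin; rewrite eq_sym.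
rewrite /prefix_dist; case: pselect => // -[n abn].
by exfalso; apply: ne; exists n; rewrite eq_sym.
Qed.

Lemma prefix_dist_ge0 x y : 0 <= prefix_dist x y.
Proof. by rewrite /prefix_dist; case: pselect. Qed.

Lemma prefix_dist_triangle y x z :
  prefix_dist x z <= prefix_dist x y + prefix_dist y z.
Proof.
rewrite {1}/prefix_dist; case: pselect => [e|_]; last first.
  by rewrite addr_ge0// prefix_dist_ge0.
case: ex_minnP => m xzm _; rewrite leNgt; apply/negP => lt.
have xy : agree m.+1 x y.
  by apply/prefix_dist_lt; apply: le_lt_trans lt; rewrite lerDl prefix_dist_ge0.
have yz : agree m.+1 y z.
  by apply/prefix_dist_lt; apply: le_lt_trans lt; rewrite lerDr prefix_dist_ge0.
by move: xzm; rewrite xy// yz// eqxx.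
Qed.

Lemma prefix_distxx x : prefix_dist x x = 0.
Proof.
by rewrite /prefix_dist; case: pselect => // e; have [n] := e; rewrite eqxx.
Qed.

Lemma prefix_dist_eq0 x y : prefix_dist x y = 0 -> x = y.
Proof.
move=> xy0; apply/funext => n.
by have /prefix_dist_lt : prefix_dist x y < n.+1%:R^-1; [rewrite xy0|exact].
Qed.

End PrefixDistance.

(** The real field is a parameter of the type because the distance takes its
    values there. *)
Definition prefix_space (R : realType) (X : set points) : Type := set_type X.

HB.instance Definition _ (R : realType) (X : set points) :=
  Choice.on (prefix_space R X).

HB.instance Definition _ (R : realType) (X : set points) :=
  @isMetric.Build R (prefix_space R X)
    (fun x y => prefix_dist (val x) (val y))
    (fun x => prefix_distxx _)
    (fun x y xy0 => val_inj (prefix_dist_eq0 xy0))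
    (fun x y => prefix_dist_sym _ _)
    (fun y x z => prefix_dist_triangle _ _ _).

Section PrefixSpace.
Context {R : realType} {X : set points}.
Local Notation space := (prefix_space R X).
Implicit Types (x y : space) (U : set space).

Lemma nbhs_prefixP x U :
  nbhs x U <-> exists k, forall y, agree k (val x) (val y) -> U y.
Proof.
split=> [/nbhs_ballP[_/posnumP[e] eU]|[k kU]].
  have [k _ ke] := near_infty_natSinv_lt e.
  exists k.+1 => y xy; apply: eU; rewrite ballEmdist/=.
  by apply: lt_trans (ke k (leqnn k)); apply/prefix_dist_lt.
apply/nbhs_ballP; exists k.+1%:R^-1; first by rewrite /= invr_gt0.
move=> y; rewrite ballEmdist/= => /prefix_dist_lt xy.
by apply: kU => n nk; apply: xy; exact: ltnW.
Qed.

Lemma uniformly_locally_constant_continuous (Z : topologicalType)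
    (f : space -> Z) k :
  (forall x y, agree k (val x) (val y) -> f x = f y) -> continuous f.
Proof.
move=> fk x W /nbhs_singleton Wfx; apply/nbhs_prefixP.
by exists k => y /fk E; rewrite /= -E.
Qed.

Lemma cylinder_clopen k x : clopen [set y : space | agree k (val x) (val y)].
Proof.
split.
  rewrite openE => y xy; apply/nbhs_prefixP.
  by exists k => z; exact: agree_trans.
rewrite -openC openE => y /= nxy; apply/nbhs_prefixP; exists k => z yz xz.
by apply: nxy; apply: agree_trans xz _; exact: agree_sym.
Qed.

Lemma prefix_space_clopen_basis : has_clopen_basis space.
Proof.
exists [set U | exists k x, U = [set y : space | agree k (val x) (val y)]].
  split=> [_ [k [x ->]]|x U /nbhs_prefixP[k kU]].
    by have [] := cylinder_clopen k x.
  exists [set y : space | agree k (val x) (val y)] => //.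
  by split=> //; exists k, x.
by move=> _ [k [x ->]]; exact: cylinder_clopen.
Qed.

Lemma prefix_space_separable : eventually_zero `<=` X -> separable_space space.
Proof.
move=> finX; exists [set x : space | eventually_zero (val x)].
  apply: sub_countable countable_eventually_zero.
  apply/pcard_leP/injfunPex; exists val => // x y _ _; exact: val_inj.
move=> U [x Ux]; rewrite openE => /(_ _ Ux)/nbhs_prefixP[k kU].
pose y : points := fun n => (n < k)%N && val x n.
have fy : eventually_zero y by exists k => // n /= kn; rewrite /y ltnNge kn.
exists (exist _ y (mem_set (finX y fy)) : space); split => //.
by apply: kU => n nk; rewrite /= /y nk.
Qed.

Lemma prefix_space_set_of_reals :
  eventually_zero `<=` X -> set_of_reals R (prefix_space R X).
Proof.
move=> finX; split.
- exact: prefix_space_clopen_basis.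
- exact: prefix_space_separable.
- by exists space, id, id; split=> // x; exact: cvg_id.
Qed.

End PrefixSpace.

(** * Pointwise convergence and step functions *)

Section PointwiseTopology.
Context {R : realType} {X : topologicalType} {A : set {ptws X -> R}}.
Implicit Types (f h : A) (U : set A) (s : seq X).

Definition close_on s (e : R) (f h : X -> R) : Prop :=
  forall x, x \in s -> `|h x - f x| < e.

Lemma nbhs_close_on f s e : 0 < e ->
  nbhs f [set h : A | close_on s e (val f) (val h)].
Proof.
move=> e0; elim: s => [|x s IH]; first by apply: filterE.
have eval_cont : {for f, continuous (fun h : A => val h x)}.
  apply: (@continuous_comp A {ptws X -> R} R val (fun g => g x)).
    exact: initial_continuous.
  exact: (@proj_continuous X (fun=> R) x).
have near_x : nbhs f [set h : A | ball (val f x) e (val h x)].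
  by apply: eval_cont; exact: nbhsx_ballx.
apply: filterS (filterI near_x IH) => h [hx hs] y.
rewrite inE => /predU1P[->|/hs//].
by rewrite distrC; exact: hx.
Qed.

(** The boxes generate a filter that converges pointwise to [f], hence is finer
    than the neighborhood filter of the product topology. *)
Lemma nbhs_pointwise f U : nbhs f U ->
  exists s, exists2 e, 0 < e & forall h, close_on s e (val f) (val h) -> U h.
Proof.
pose box := filter_from [set p : seq X * R | 0 < p.2]
  (fun p => [set h : {ptws X -> R} | close_on p.1 p.2 (val f) h]).
have Fbox : Filter box.
  apply: filter_from_filter; first by exists ([::], 1) => /=.
  move=> [s d] [t e] /= d0 e0; exists (s ++ t, Num.min d e).
    by rewrite /= lt_min d0.
  move=> h hst; split=> x xs; have := hst x; rewrite /= mem_cat xs ?orbT;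
    by rewrite lt_min => /(_ isT)/andP[].
have cvg_box : {ptws, box --> (val f : X -> R)}.
  apply/pointwise_cvgP => x W /nbhs_ballP[e /= e0 eW].
  exists ([:: x], e) => // h /(_ x); rewrite inE eqxx => /(_ isT) => hx.
  by apply: eW; rewrite /ball/= distrC.
rewrite nbhsE => -[W [[V oV <-] Vf] VU].
have [[s e] /= e0 eV] : box V by apply: cvg_box; exact: open_nbhs_nbhs.
by exists s, e => // h /eV Vh; exact: VU.
Qed.

Lemma dense_pointwiseP (D : set A) : dense D <->
  forall f s e, 0 < e -> exists2 h, D h & close_on s e (val f) (val h).
Proof.
split=> [dD f s e e0|H O [f Of]].
  have [||h [Oh Dh]] := dD ([set h : A | close_on s e (val f) (val h)]^°).
  - by exists f; exact: nbhs_close_on.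
  - exact: open_interior.
  - by exists h => //; exact: interior_subset Oh.
rewrite openE => /(_ _ Of)/nbhs_pointwise[s [e e0 eO]].
by have [h Dh /eO Oh] := H f s e e0; exists h.
Qed.

Lemma cvg_pointwiseP (u : nat -> A) f :
  u @ \oo --> f <-> forall x, val (u n) x @[n --> \oo] --> val f x.
Proof.
split=> [uf x|uf U /nbhs_pointwise[s [e e0 eU]]].
  apply/cvgrPdist_lt => e e0.
  have near_f : \forall n \near \oo, close_on [:: x] e (val f) (val (u n)).
    exact: uf _ (nbhs_close_on f [:: x] e0).
  near=> n; rewrite distrC; suff : close_on [:: x] e (val f) (val (u n)).
    by apply; rewrite inE.
  by near: n.
have : \forall n \near \oo, forall x, x \in s -> `|val (u n) x - val f x| < e.
  apply: (@near_all_seq X s (fun x n => `|val (u n) x - val f x| < e)) => x _.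
  by have /cvgrPdistC_lt := uf x; exact.
by apply: filterS => n /eU.
Unshelve. all: by end_near. Qed.

End PointwiseTopology.

Lemma rat_approx (R : realType) (r e : R) : 0 < e ->
  exists q : rat, `|ratr q - r| < e.
Proof.
move=> e0; have /rat_in_itvoo[q] : r < r + e by rewrite ltrDl.
rewrite in_itv/= => /andP[rq qr]; exists q.
by rewrite ger0_norm ?subr_ge0 1?ltW// ltrBlDl.
Qed.

(** The countably many locally constant functions with rational values: [c.1] is
    the length of the prefixes read, and [c.2] lists values for some of the
    prefixes, the others being sent to [0]. *)
Definition step_function (R : realType) (c : nat * seq (seq bool * rat))
    (x : points) : R :=
  ratr (nth 0 (unzip2 c.2) (index (mkseq x c.1) (unzip1 c.2))).

Lemma step_function_agree (R : realType) c (x y : points) :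
  agree c.1 x y -> step_function R c x = step_function R c y.
Proof. by move=> /mkseq_agree E; rewrite /step_function E. Qed.

Lemma step_function_dense (R : realType) (f : points -> R) (s : seq points) e :
  0 < e -> exists c, forall x, x \in s -> `|step_function R c x - f x| < e.
Proof.
move=> e0; have [k kP] := separating_prefix s.
have /choice[q qP] : forall x, exists q : rat, `|ratr q - f x| < e.
  by move=> x; exact: rat_approx.
exists (k, [seq (mkseq x k, q x) | x <- s]) => x xs.
rewrite /step_function /= /unzip1 /unzip2 -!map_comp /comp /=.
set i := index _ _.
have iE : i = index x s.
  rewrite /i; elim: s xs kP {i} => //= y s IH xs kP.
  case: eqP => [E|nE].
    have -> : y = x by apply: kP; rewrite ?mem_head//; exact/mkseq_agree.
    by rewrite eqxx.
  have yx : y != x by apply/eqP => yx; apply: nE; rewrite yx.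
  rewrite (negbTE yx); congr _.+1; apply: IH.
    by move: xs; rewrite inE eq_sym (negbTE yx).
  by move=> a b sa sb; apply: kP; rewrite inE ?sa ?sb orbT.
by rewrite iE (nth_map x) ?index_mem// nth_index.
Qed.

(** * Sequential density in the two function spaces *)

Lemma Cp_continuous (R : realType) (Y : topologicalType) (f : Cp R Y) :
  continuous (val f : Y -> R).
Proof. exact: set_mem (valP f). Qed.

Lemma near_distance_lt (R : realType) (Y : topologicalType) (f g : Y -> R) x e :
  continuous f -> continuous g -> `|f x - g x| < e ->
  \forall y \near x, `|f y - g y| < e.
Proof.
move=> cf cg; apply: (cvgr_norm_lt (f x - g x)).
by apply: cvgB; [exact: cf|exact: cg].
Qed.

Section GammaSpace.
Context {R : realType} {X : set points} (zeroX : eventually_zero `<=` X).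
Local Notation space := (prefix_space R X).

Lemma step_function_approx (f : space -> R) (s : seq space) e : 0 < e ->
  exists c, close_on s e f (fun x : space => step_function R c (val x)).
Proof.
move=> e0; pose f' (y : points) := if insub y is Some x then f x else 0.
have [c cP] := step_function_dense f' (map val s) e0.
exists c => x xs; have := cP (val x) (map_f _ xs).
by rewrite /f' valK.
Qed.

Lemma step_function_continuous c :
  continuous (fun x : space => step_function R c (val x)).
Proof.
apply: (@uniformly_locally_constant_continuous _ _ _ _ c.1) => x y.
exact: step_function_agree.
Qed.

Lemma Cp_separable : separable_space (Cp R space).
Proof.
pose F c : Cp R space := exist _ (fun x : space => step_function R c (val x))
  (mem_set (@step_function_continuous c)).
exists (range F).
  by apply: card_le_trans (card_image_le _ _) _; exact: countableP.
apply/dense_pointwiseP => f s e e0.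
have [c cP] := step_function_approx (val f) s e0.
by exists (F c).
Qed.

(** The sets where a member of [D] is within [1/(j+1)] of [z] must be used with
    [j] tending to infinity along the subsequence. Removing the singleton of [j]
    from them achieves this, since that point eventually has to be covered. *)
Lemma Cp_strongly_sequentially_separable :
  gamma_set X -> strongly_sequentially_separable (Cp R space).
Proof.
move=> gX; split; first exact: Cp_separable.
move=> D cD /dense_pointwiseP dD z.
have [h0 Dh0 _] := dD z [::] 1 ltr01.
move: cD => /pfcard_geP[D0|[d]]; first by rewrite D0 in Dh0.
pose kappa n := (odflt (0, 0)%N (choice.unpickle n)).1.
pose nu n := (odflt (0, 0)%N (choice.unpickle n)).2.
pose good n (x : space) := `|val (d (kappa n)) x - val z x| < (nu n).+1%:R^-1 /\
  val x <> indicator1 (nu n).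
pose U n : set points := [set y | exists2 x : space, val x = y & good n x].
have UX n (x : space) : U n (val x) <-> good n x.
  by split=> [[x' /val_inj ->]|]; last by exists x.
have [n|s sX N|t tP] := gX U.
- move=> y Xy [x <- [xz xn]].
  have near1 : nbhs x
      [set w | `|val (d (kappa n)) w - val z w| < (nu n).+1%:R^-1].
    by apply: near_distance_lt xz; exact: Cp_continuous.
  have near2 : nbhs x [set w : space | val w <> indicator1 (nu n)].
    have [q xq] : exists q, val x q != indicator1 (nu n) q.
      apply: contrapT => /forallNP H; apply: xn; apply/funext => q.
      by apply/eqP/negPn/negP; exact: H.
    apply/nbhs_prefixP; exists q.+1 => w /(_ q (ltnSn q)) E wn.
    by move: xq; rewrite E wn eqxx.
  have /nbhs_prefixP[k kP] : nbhs x (good n) by exact: filterI near1 near2.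
  by exists k => v Xv xv; exists (exist _ v (mem_set Xv)) => //; exact: kP.
- have far (y : points) : \forall j \near \oo, y <> indicator1 j.
    have [[j0 ->]|ny] := pselect (exists j, y = indicator1 j); last first.
      by exists 0%N => // j _ yj; apply: ny; exists j.
    exists j0.+1 => // j /= j0j /(congr1 (@^~ j)).
    by rewrite /indicator1 eqxx gtn_eqF.
  have [J _ JP] : \forall j \near \oo, forall y, y \in s -> y <> indicator1 j.
    exact: (@near_all_seq _ s (fun y j => y <> indicator1 j)).
  (* An index [n < N] has [nu n < j], so every code of a pair with second
     component [j] is at least [N]. *)
  pose j := maxn J (\max_(n < N) nu n).+1.
  have j0 : 0 < j.+1%:R^-1 :> R by rewrite invr_gt0.
  have [h Dh hz] := dD z (pmap insub s : seq space) _ j0.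
  have [k _ dk] := @surj _ _ _ _ d h Dh.
  pose n := choice.pickle (k, j).
  have kn : kappa n = k by rewrite /kappa /n choice.pickleK.
  have jn : nu n = j by rewrite /nu /n choice.pickleK.
  exists n => [|y ys].
    rewrite leqNgt; apply/negP => nN.
    have : (nu n <= \max_(n < N) nu n)%N by exact: (leq_bigmax (Ordinal nN)).
    by rewrite jn; apply/negP; rewrite -ltnNge leq_max ltnSn orbT.
  have Xy : y \in X by apply/mem_set/sX.
  apply: (UX n (exist _ y Xy)).2; rewrite /good kn jn dk; split.
    by apply: hz; rewrite mem_pmap_sub.
  by apply: JP ys; rewrite /= leq_max leqnn.
- have tP' (x : space) : \forall l \near \oo, good (t l) x.
    have Xx : X (val x) by case: x => ? /= /set_mem.
    by move: (tP _ Xx); apply: filterS => l /UX.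
  have nu_oo : forall J, \forall l \near \oo, (J <= nu (t l))%N.
    apply: near_neq_all => j.
    have Xj := mem_set (zeroX (indicator1_eventually_zero j)).
    pose xj : space := exist _ (indicator1 j) Xj.
    by move: (tP' xj); apply: filterS => l [_ +] E; rewrite E.
  exists (fun l => d (kappa (t l))); first by move=> l; exact: funS.
  apply/cvg_pointwiseP => x; apply/cvgrPdistC_lt => e e0.
  have [J _ Je] := near_infty_natSinv_lt (PosNum e0).
  apply: filterS2 (tP' x) (nu_oo J) => l [lx _] Jl.
  exact: lt_trans lx (Je _ Jl).
Qed.

(** The value off the window is [1], so that convergence to [0] at a point
    forces the point into the windows. *)
Definition windowed_step (p : (nat * seq (seq bool * rat)) * (nat * nat))
    (y : points) : R :=
  if `[< window p.2.1 p.2.2 y >] then step_function R p.1 y else 1.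

Lemma windowed_step_baire1 p : exists2 g : nat -> space -> R,
  (forall k, continuous (g k)) &
  forall x : space, g k x @[k --> \oo] --> windowed_step p (val x).
Proof.
case: p => c [n m].
exists (fun k x => if `[< window n m (truncate k (val x)) >]
                   then step_function R c (val x) else 1) => [k|x].
  apply: (@uniformly_locally_constant_continuous _ _ _ _ (maxn k c.1)).
  move=> x y xy.
  rewrite (step_function_agree R (leq_agree (leq_maxr k c.1) xy)).
  suff -> : truncate k (val x) = truncate k (val y) by [].
  apply/funext => q; rewrite /truncate; case: ltnP => //= qk.
  by apply: xy; rewrite leq_max qk.
apply: cvg_near_cst; move: (window_truncate n m (val x)).
by apply: filterS => k H; rewrite /windowed_step /= (propext H).
Qed.

Lemma zero_baire1 : exists2 g : nat -> space -> R,
  (forall k, continuous (g k)) &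
  forall x : space, g k x @[k --> \oo] --> (0 : R).
Proof.
exists (fun _ _ => 0) => [k|x]; last exact: cvg_cst.
by move=> x; exact: cst_continuous.
Qed.

(** Along a sequence converging to [0] every point is eventually in the windows,
    whose left ends tend to infinity. So for each [q] some window of index at
    least [q] has left end at least [q]. An infinite point that has, after each
    of its elements [q], a gap up to the right end of that window is outside
    infinitely many windows. *)
Lemma B1_not_strongly_sequentially_separable :
  (forall g, exists2 x, X x & frequently x /\ gapped g x) ->
  ~ strongly_sequentially_separable (B1 R space).
Proof.
move=> gapX [_ sss].
pose F p : B1 R space := exist _ (fun x : space => windowed_step p (val x))
  (mem_set (windowed_step_baire1 p)).
pose zero : B1 R space := exist _ (fun=> 0) (mem_set zero_baire1).
have [||u uF uz] := sss (range F) _ _ zero.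
- by apply: card_le_trans (card_image_le _ _) _; exact: countableP.
- apply/dense_pointwiseP => f s e e0.
  have [n [m nmP]] := windows_omega_cover (map val s).
  have [c cP] := step_function_approx (val f) s e0.
  exists (F (c, (n, m))) => // x xs; rewrite /= /windowed_step /=.
  rewrite asboolT; first exact: cP.
  exact/nmP/map_f.
have /choice[p pP] : forall l, exists p, F p = u l.
  by move=> l; have [p _ pu] := uF l; exists p.
pose n l := (p l).2.1; pose m l := (p l).2.2.
have uw (y : points) : X y -> \forall l \near \oo, window (n l) (m l) y.
  move=> Xy; pose x : space := exist _ y (mem_set Xy).
  have /cvg_pointwiseP/(_ x)/cvgrPdist_lt/(_ 1 ltr01) := uz.
  apply: filterS => l; rewrite -pP /= /windowed_step /=.
  by case: asboolP => // _; rewrite sub0r normrN normr1 ltxx.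
have n_oo : forall J, \forall l \near \oo, (J <= n l)%N.
  apply: near_neq_all => j; have := uw _ (zeroX (indicator1_eventually_zero j)).
  by apply: filterS => l + nl; rewrite nl; exact: window_indicator1.
have /choice[kappa kP] : forall q, exists l, (q <= l)%N /\ (q <= n l)%N.
  move=> q; have [L _ LP] := n_oo q.
  exists (maxn q L); rewrite leq_maxl; split=> //.
  by apply: LP; exact: leq_maxr.
have [x Xx [fx gx]] := gapX (fun q => m (kappa q)).
have [L _ LP] := uw x Xx.
have [q Lq xq] := fx L.
have [qk qn] := kP q.
case: (LP (kappa q) (leq_trans Lq qk)) => [xn|[r /andP[nr rm] xr]].
  by have [r nr /xn] := fx (n (kappa q)); rewrite ltnNge nr.
suff /negP : ~~ x r by [].
by apply: gx xq _; rewrite (leq_ltn_trans qn nr) rm.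
Qed.

End GammaSpace.

Theorem theorem4p27 (R : realType) :
  p_eq_c ->
  exists X : topologicalType,
    [/\ set_of_reals R X,
        strongly_sequentially_separable (Cp R X) &
        ~ strongly_sequentially_separable (B1 R X)].
Proof.
move=> pc; have [X [zeroX gammaX gapX]] := exists_gapped_gamma_set pc.
exists (prefix_space R X); split.
- exact: prefix_space_set_of_reals.
- exact: Cp_strongly_sequentially_separable.
- exact: B1_not_strongly_sequentially_separable.
Qed.
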